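(* Let $G$ be a countable abelian group such that $2G$ is infinite. Then there exists a set $A\subset G$ with upper Banach density equal to $1$ such that $t+B+B\not\subset A$ for any infinite set $B\subset G$ and any element $t\in G$.
   Context: $2G=\{g+g: g\in G\}$. A Følner sequence in $G$ is a sequence $\Phi=(\Phi_N)_{N\in\mathbb{N}}$ of (nonempty) finite subsets of $G$ with $\lim_{N\to\infty}\frac{|\Phi_N\cap(g+\Phi_N)|}{|\Phi_N|}=1$ for every $g\in G$. $\overline{\mathrm{d}}_\Phi(A)=\limsup_{N\to\infty}\frac{|A\cap\Phi_N|}{|\Phi_N|}$. The upper Banach density of $A\subset G$ is the supremum of $\overline{\mathrm{d}}_\Phi(A)$ over all Følner sequences $\Phi$ in $G$. $t+B+B=\{t+b_1+b_2: b_1,b_2\in B\}$ (with $b_1=b_2$ allowed). *)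

(* Defs.v *)
From HB Require Import structures.
From mathcomp Require Import all_boot all_order all_algebra.
From mathcomp Require Import finmap.
From mathcomp Require Import all_classical all_reals all_analysis.
Set Implicit Arguments.
Unset Strict Implicit.
Unset Printing Implicit Defensive.
Import Order.TTheory GRing.Theory Num.Theory.
Import numFieldNormedType.Exports.
Local Open Scope classical_set_scope.
Local Open Scope ring_scope.

Definition translate (G : zmodType) (g : G) (F : {fset G}) : {fset G} :=
  [fset (g + x)%R | x in F]%fset.

Definition folner (R : realType) (G : zmodType) (Phi : nat -> {fset G}) : Prop :=
  (forall N, Phi N != fset0) /\
  (forall g : G,
     (#|` (Phi N `&` translate g (Phi N))%fset |%:R / #|` Phi N |%:R : R)
       @[N --> \oo] --> (1 : R)).

(* The upper densities take values in the extended reals, where the limit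
   superior and the supremum are total. *)
Definition upper_density (R : realType) (G : zmodType) (Phi : nat -> {fset G})
    (A : set G) : \bar R :=
  limn_esup (fun N =>
    (#|` [fset x in Phi N | x \in A]%fset |%:R / #|` Phi N |%:R : R)%:E).

Definition upper_banach_density (R : realType) (G : zmodType) (A : set G)
    : \bar R :=
  ereal_sup [set upper_density R Phi A | Phi in folner R (G := G)].

(* Main.v *)
Require Import Defs.
From HB Require Import structures.
From mathcomp Require Import all_boot all_order all_algebra.
From mathcomp Require Import finmap.
From mathcomp Require Import all_classical all_reals all_analysis.
Set Implicit Arguments.
Unset Strict Implicit.
Unset Printing Implicit Defensive.
Import Order.TTheory GRing.Theory Num.Theory.
Import numFieldNormedType.Exports.
Local Open Scope classical_set_scope.
Local Open Scope ring_scope.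

(** The set A is a union of translates x_N + F_N of the members of a Folner
    sequence F; the translates form a Folner sequence contained in A, so A has
    upper Banach density 1 whatever the x_N are
    ([upper_banach_density_folner]).

    Let e_0, e_1, ... enumerate G and put
    E_N = {z + z + e_i : z in F_N, i <= N}, a finite set. Since 2G is infinite,
    the x_N can be chosen one after the other so far apart that every
    2 x_N + E_N is disjoint from A ([doubling_escapes]). Suppose now that
    t + B + B is contained in A with B infinite. Fix b_1 in B. As b_2 runs over
    B, the elements t + b_1 + b_2 of A leave every finite union of the
    x_N + F_N, so t + b_1 + b_2 = x_N + z with z in F_N for some N at least as
    large as the index of - (t + 2 b_1) in the enumeration. Then
      t + 2 b_2 = 2 (t + b_1 + b_2) - (t + 2 b_1)
                = 2 x_N + z + z - (t + 2 b_1)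
    lies in 2 x_N + E_N, hence outside A, although it belongs to t + B + B.

    Folner sequences exist in every countable abelian group because finitely
    many elements e_0, ..., e_(n-1) generate a group of polynomial growth: the
    set of sums of k_i e_i with 0 <= k_i < L has at most L ^ n elements, and a
    sequence with such a bound cannot grow by a factor 1 + eps at every step.
    Where it grows by less, the box for L is almost invariant under each e_i
    ([almost_invariant]), since adding e_i maps it into the box for L + 1. *)

(** * Existence of Folner sequences *)

Lemma bernoulli_ineq (R : realDomainType) (x : R) (n : nat) :
  0 <= x -> 1 + x *+ n <= (1 + x) ^+ n.
Proof.
move=> x_ge0; elim: n => [|n IHn]; first by rewrite mulr0n addr0 expr0.
rewrite exprS; apply: le_trans (ler_wpM2l _ IHn); last exact: addr_ge0.
by rewrite mulrDl mul1r mulrDr mulr1 mulrSr !addrA lerDl mulr_ge0 ?mulrn_wge0.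
Qed.

(** Otherwise a (L + 1) >= (1 + eps) ^ L for all L. Along L = k (d + 1),
    Bernoulli's inequality turns this lower bound into a polynomial of degree
    d + 1 in k, which eventually exceeds the upper bound of degree d. *)
Lemma slow_step_of_polynomial_growth (R : archiRealFieldType) (a : nat -> nat)
    (d : nat) (eps : R) :
  0 < eps -> (0 < a 1)%N -> (forall L, (a L <= L ^ d)%N) ->
  exists2 L, (0 < L)%N & (a L.+1)%:R <= (1 + eps) * (a L)%:R.
Proof.
move=> eps_gt0 a1_gt0 a_poly; apply: contrapT => no_slow.
have eps_ge0 := ltW eps_gt0.
have a_exp L : (1 + eps) ^+ L <= (a L.+1)%:R.
  elim: L => [|L IHL]; first by rewrite expr0 ler1n.
  have [//|step] := leP (a L.+2)%:R ((1 + eps) * (a L.+1)%:R).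
    by move=> le_step; exfalso; apply: no_slow; exists L.+1.
  apply: le_trans (ltW step); rewrite exprS ler_wpM2l //.
  by rewrite addr_ge0.
(* C is the bound on k obtained by dividing
   (k eps) ^ (d + 1) <= (k (d + 2)) ^ d by k ^ d eps ^ (d + 1). *)
pose C : R := d.+2%:R ^+ d / eps ^+ d.+1.
have C_ge0 : 0 <= C by rewrite divr_ge0 ?exprn_ge0.
have := archi_boundP C_ge0; set k := Num.bound C => ltCk.
have k_gt0 : (0 < k)%N by rewrite -(ltr_nat R); apply: le_lt_trans ltCk.
have k_gt0R : 0 < k%:R :> R by rewrite ltr0n.
suff : k%:R <= C by rewrite leNgt ltCk.
rewrite /C ler_pdivlMr ?exprn_gt0 //.
rewrite -(ler_pM2l (exprn_gt0 d k_gt0R)) mulrA -exprSr -!exprMn.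
apply: (@le_trans _ _ ((1 + eps *+ k) ^+ d.+1)).
  rewrite lerXn2r ?nnegrE ?addr_ge0 ?mulr_ge0 ?mulrn_wge0 //.
  by rewrite mulr_natl lerDr.
apply: (@le_trans _ _ (((1 + eps) ^+ k) ^+ d.+1)).
  rewrite lerXn2r ?nnegrE ?exprn_ge0 ?addr_ge0 ?mulrn_wge0 //.
  exact: bernoulli_ineq.
rewrite -exprM; apply: le_trans (a_exp _) _.
rewrite -natrM -natrX ler_nat; apply: leq_trans (a_poly _) _.
have [->//|d_gt0] := posnP d; rewrite leq_exp2r //.
by rewrite (mulnS k d.+1) -add1n leq_add2r.
Qed.

Definition box_sum (G : zmodType) (e : nat -> G) (n L : nat)
    (f : {ffun 'I_n -> 'I_L}) : G := \sum_(i < n) e i *+ f i.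

Definition box (G : zmodType) (e : nat -> G) (n L : nat) : {fset G} :=
  [fset box_sum e f | f in {: {ffun 'I_n -> 'I_L}}]%fset.

Lemma card_box (G : zmodType) (e : nat -> G) (n L : nat) :
  (#|` box e n L| <= L ^ n)%N.
Proof.
rewrite /box; apply: leq_trans (leq_imfset_card _ _ _) _.
by rewrite -cardE card_ffun !card_ord.
Qed.

Lemma box_neq0 (G : zmodType) (e : nat -> G) (n L : nat) :
  (0 < L)%N -> box e n L != fset0.
Proof.
case: L => // L _; apply/fset0Pn.
exists (box_sum e [ffun _ : 'I_n => ord0 : 'I_L.+1]).
by apply/imfsetP; eexists.
Qed.

Lemma box_widen (G : zmodType) (e : nat -> G) (n L : nat) :
  (box e n L `<=` box e n L.+1)%fset.
Proof.
apply/fsubsetP => _ /imfsetP[f _ ->]; apply/imfsetP.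
exists [ffun i => widen_ord (leqnSn L) (f i)] => //=.
by apply: eq_bigr => i _; rewrite ffunE.
Qed.

Lemma translate_box (G : zmodType) (e : nat -> G) (n L : nat) (i : 'I_n) :
  (translate (e i) (box e n L) `<=` box e n L.+1)%fset.
Proof.
apply/fsubsetP => _ /imfsetP[_ /imfsetP[f _ ->] ->]; apply/imfsetP.
have lt_fi j : (f j + (j == i) < L.+1)%N.
  have := ltn_ord (f j).
  by case: (j == i); rewrite ?addn1 ?addn0 ltnS // => /ltnW.
exists [ffun j => Ordinal (lt_fi j)] => //=.
rewrite /box_sum (bigD1 i) //= [RHS](bigD1 i) //= ffunE /= eqxx addn1 mulrS.
rewrite addrA; congr (_ + _); apply: eq_bigr => j ne_ji.
by rewrite ffunE /= (negPf ne_ji) addn0.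
Qed.

Lemma in_translate (G : zmodType) (g x : G) (F : {fset G}) :
  (x \in translate g F) = (x - g \in F).
Proof.
apply/imfsetP/idP => [[y yF ->]|xgF]; first by rewrite addrC addKr.
by exists (x - g) => //; rewrite addrC subrK.
Qed.

Lemma card_translate (G : zmodType) (g : G) (F : {fset G}) :
  #|` translate g F| = #|` F|.
Proof. by rewrite card_imfset //; exact: addrI. Qed.

Lemma translateI (G : zmodType) (g : G) (E F : {fset G}) :
  translate g (E `&` F)%fset = (translate g E `&` translate g F)%fset.
Proof. by apply/fsetP => x; rewrite !inE !in_translate inE. Qed.

Lemma translateC (G : zmodType) (g h : G) (F : {fset G}) :
  translate g (translate h F) = translate h (translate g F).
Proof. by apply/fsetP => x; rewrite !in_translate addrAC. Qed.

Lemma translate_neq0 (G : zmodType) (g : G) (F : {fset G}) :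
  F != fset0 -> translate g F != fset0.
Proof. by rewrite -!cardfs_gt0 card_translate. Qed.

(** If F is a box whose successor has at most (1 + eps) |F| elements, then both
    F and e_i + F lie in that successor, and inclusion-exclusion gives
    |F cap (e_i + F)| >= 2 |F| - (1 + eps) |F|. *)
Lemma almost_invariant (R : archiRealFieldType) (G : zmodType) (e : nat -> G)
    (n : nat) (eps : R) : 0 < eps ->
  exists F : {fset G}, F != fset0 /\ forall i, (i < n)%N ->
    1 - eps <= #|` (F `&` translate (e i) F)%fset|%:R / #|` F|%:R.
Proof.
move=> eps_gt0.
have [||L L_gt0 slow] := @slow_step_of_polynomial_growth _
  (fun L => #|` box e n L|) n _ eps_gt0.
- by rewrite cardfs_gt0 box_neq0.
- exact: card_box.
exists (box e n L); split=> [|i lt_in]; first exact: box_neq0.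
set F := box e n L; set T := translate (e i) F.
have F_gt0 : 0 < #|` F|%:R :> R by rewrite ltr0n cardfs_gt0 box_neq0.
rewrite ler_pdivlMr // mulrBl mul1r lerBlDr -(lerD2l #|` F|%:R).
have TE : #|` T| = #|` F| by rewrite card_translate.
have : #|` (F `|` T)%fset|%:R <= (1 + eps) * #|` F|%:R.
  apply: le_trans slow; rewrite ler_nat fsubset_leq_card // fsubUset.
  by rewrite box_widen (translate_box _ _ (Ordinal lt_in)).
rewrite mulrDl mul1r => union_le.
have UI : #|` (F `|` T)%fset|%:R + #|` (F `&` T)%fset|%:R =
    #|` F|%:R + #|` F|%:R :> R by rewrite -!natrD cardfsUI TE.
by rewrite -UI [leLHS]addrC [leRHS]addrCA lerD2l.
Qed.

Lemma folner_translate (R : realType) (G : zmodType) (x : nat -> G)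
    (F : nat -> {fset G}) :
  folner R F -> folner R (fun N => translate (x N) (F N)).
Proof.
move=> [F_neq0 F_inv]; split=> [N|g]; first exact: translate_neq0.
under eq_fun do rewrite translateC -translateI !card_translate.
exact: F_inv.
Qed.

(** A diagonal choice: the N-th set is invariant up to 1 / (N + 1) under the
    first N elements of the enumeration, and each g is eventually among them. *)
Lemma folner_exists (R : realType) (G : zmodType) (e : nat -> G) :
  (forall g, exists n, e n = g) -> exists F, folner R (G := G) F.
Proof.
move=> e_surj.
have /choice[F F_inv] : forall N, exists F : {fset G}, F != fset0 /\
    forall i, (i < N)%N ->
    1 - N.+1%:R^-1 <= #|` (F `&` translate (e i) F)%fset|%:R / #|` F|%:R :> R.
  by move=> N; apply: almost_invariant; rewrite invr_gt0.
exists F; split=> [N|g]; first by have [] := F_inv N.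
have [i <-] := e_surj g.
apply: (@squeeze_cvgr _ _ _ _ (fun N => 1 - N.+1%:R^-1) (fun=> 1)).
- near=> N; have [F_neq0 ->] := F_inv N; last by near: N; exists i.+1.
  rewrite ler_pdivrMr ?ltr0n ?cardfs_gt0 // mul1r ler_nat.
  by rewrite fsubset_leq_card // fsubsetIl.
- rewrite -[X in _ --> X]subr0; apply: cvgB; first exact: cvg_cst.
  exact: cvg_harmonic.
- exact: cvg_cst.
Unshelve. all: by end_near. Qed.

Lemma countable_enumeration (G : zmodType) :
  countable [set: G] -> exists e : nat -> G, forall g, exists n, e n = g.
Proof.
move=> /countable_injP[f f_inj].
exists (fun n => xget 0 [set g | f g = n]) => g; exists (f g).
case: xgetP => [h _ /= fh|/(_ g) []//]; apply: f_inj fh; exact: mem_set.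
Qed.

(** * Sets containing a Folner sequence *)

Lemma upper_density_le1 (R : realType) (G : zmodType) (Phi : nat -> {fset G})
    (A : set G) : (upper_density R Phi A <= 1)%E.
Proof.
(* The limit superior is at most the supremum of all the terms. *)
apply: ge_ereal_inf; exists (ereal_sup (range (fun N =>
  (#|` [fset x in Phi N | x \in A]%fset|%:R / #|` Phi N|%:R : R)%:E))).
  by exists setT => //; exact: filterT.
apply: ge_ereal_sup => _ [N _ <-]; rewrite lee_fin.
have [->|Phi_gt0] := posnP #|` Phi N|; first by rewrite invr0 mulr0.
rewrite ler_pdivrMr ?ltr0n // mul1r ler_nat fsubset_leq_card //.
by apply/fsubsetP => y; rewrite !inE => /andP[].
Qed.

Lemma upper_banach_density_folner (R : realType) (G : zmodType)
    (Phi : nat -> {fset G}) (A : set G) :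
  folner R Phi -> (forall N x, x \in Phi N -> A x) ->
  upper_banach_density R A = 1%E.
Proof.
move=> Phi_folner PhiA; apply/le_anti/andP; split.
  by apply: ge_ereal_sup => _ [Psi _ <-]; exact: upper_density_le1.
apply: ereal_sup_ubound; exists Phi => //; rewrite /upper_density.
rewrite (_ : (fun N => _) = cst 1%E) ?(cvg_limn_einf_sup (cvg_cst 1%E)) //.
apply/funext => N /=; have /= := Phi_folner.1 N.
rewrite (_ : [fset x in Phi N | x \in A]%fset = Phi N).
  by rewrite -cardfs_gt0 => Phi_gt0; rewrite divff // pnatr_eq0 -lt0n.
apply/fsetP => y; rewrite !inE andb_idr // => yPhi.
by rewrite inE; exact: PhiA yPhi.
Qed.

(** * Translates avoiding their doubles *)

(** If every x with x + x outside S were in T, then 2G would be contained in the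
    finite set S cup 2T. *)
Lemma exists_double_notin (G : zmodType) (S T : set G) :
  infinite_set [set g + g | g in [set: G]] ->
  finite_set S -> finite_set T -> exists x, ~ S (x + x) /\ ~ T x.
Proof.
move=> twoG_inf finS finT; apply: contrapT => no_x; apply: twoG_inf.
apply: (@sub_finite_set _ _ (S `|` [set g + g | g in T])).
  move=> _ [g _ <-]; apply: contrapT => /not_orP[nS nT].
  by apply: no_x; exists g; split=> // Tg; apply: nT; exists g.
by rewrite finite_setU; split=> //; exact: finite_image.
Qed.

(** Keeping the whole list of earlier values as state makes the n-th choice
    subject to conditions involving all of them. *)
Lemma dependent_choice_history (T : Type) (P : seq T -> T -> Prop) :
  (forall s, exists x, P s x) ->
  exists u : nat -> T, forall n, P (mkseq u n) (u n).
Proof.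
move=> /choice[f fP]; pose h n := iter n (fun s => rcons s (f s)) [::].
exists (f \o h) => n; suff -> : mkseq (f \o h) n = h n by exact: fP.
by elim: n => // n IHn; rewrite mkseqS IHn.
Qed.

(** Each pair M, N is dealt with when the later of x_M, x_N is chosen. For M < N
    the condition keeps x_N + x_N out of a finite set; for M >= N it keeps x_M
    itself out of a finite set, the case M = N because x cancels once in
    x + x + y = x + z. Both kinds of sets can be avoided at once by
    [exists_double_notin]. *)
Lemma doubling_escapes (G : zmodType) (F E : nat -> set G) :
  infinite_set [set g + g | g in [set: G]] ->
  (forall N, finite_set (F N)) -> (forall N, finite_set (E N)) ->
  exists x : nat -> G, forall M N y z, E N y -> F M z ->
    x N + x N + y <> x M + z.
Proof.
move=> twoG_inf finF finE.
pose P (s : seq G) x := let N := size s in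
  [/\ forall M y z, (M < N)%N -> E N y -> F M z -> x + x + y <> s`_M + z,
      forall y z, E N y -> F N z -> x + x + y <> x + z
    & forall M y z, (M < N)%N -> E M y -> F N z -> s`_M + s`_M + y <> x + z].
have [s|x xP] := @dependent_choice_history _ P.
  set N := size s.
  pose S := \bigcup_(M in `I_N) [set s`_M + z - y | z in F M & y in E N].
  pose T1 := [set z - y | z in F N & y in E N].
  pose T2 := \bigcup_(M in `I_N)
    [set s`_M + s`_M + y - z | y in E M & z in F N].
  have [||x [nS /not_orP[nT1 nT2]]] :=
    @exists_double_notin G S (T1 `|` T2) twoG_inf.
  - by apply: bigcup_finite => // M _; apply: finite_image2.
  - rewrite finite_setU; split; first exact: finite_image2.
    by apply: bigcup_finite => // M _; apply: finite_image2.
  exists x; split=> [M y z ltMN Ey Fz eqx|y z Ey Fz eqx|M y z ltMN Ey Fz eqx].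
  - apply: nS; exists M => //; exists z => //; exists y => //.
    by rewrite -eqx addrK.
  - apply: nT1; exists z => //; exists y => //.
    by apply: (addrI x); rewrite addrA -eqx addrK.
  - apply: nT2; exists M => //; exists y => //; exists z => //.
    by rewrite eqx addrK.
exists x => M N y z Ey Fz.
have [ltMN|ltNM|eqMN] := ltngtP M N.
- have [+ _ _] := xP N; rewrite size_mkseq => /(_ M y z ltMN Ey Fz).
  by rewrite nth_mkseq.
- have [_ _] := xP M; rewrite size_mkseq => /(_ N y z ltNM Ey Fz).
  by rewrite nth_mkseq.
- by subst M; have [_ + _] := xP N; rewrite size_mkseq; exact.
Qed.

(** * A thick set without shifted sumsets *)

Theorem corollary5p6 (R : realType) (G : zmodType)
    (G_countable : countable [set: G])
    (twoG_infinite : infinite_set [set g + g | g in [set: G]]) :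
  exists A : set G,
    upper_banach_density R A = 1%E /\
    forall (B : set G) (t : G), infinite_set B ->
      ~ ([set t + b1 + b2 | b1 in B & b2 in B] `<=` A).
Proof.
have [e e_surj] := countable_enumeration G_countable.
have [F F_folner] := folner_exists R e_surj.
(* The term e i will absorb - (t + b1 + b1), which is some e k and hence
   available in E N as soon as k <= N. *)
pose E N := [set z + z + e i | z in [set` F N] & i in `I_N.+1].
have finE N : finite_set (E N) by exact: finite_image2.
have [x x_escapes] := doubling_escapes twoG_infinite
  (fun N => finite_fset (F N)) finE.
exists (\bigcup_N [set` translate (x N) (F N)]); split.
  apply: upper_banach_density_folner (folner_translate x F_folner) _.
  by move=> N y yPhi; exists N.
move=> B t B_inf BBA.
have [b1 Bb1] : B !=set0.
  by apply/set0P/eqP => B0; apply: B_inf; rewrite B0; exact: finite_set0.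
have [k ek] := e_surj (- (t + b1 + b1)).
(* Only finitely many b2 put t + b1 + b2 in one of the first k translates. *)
have [b2 [Bb2 far]] : exists b2, B b2 /\ forall N, (N < k)%N ->
    t + b1 + b2 \notin translate (x N) (F N).
  apply: contrapT => no_b2; apply: B_inf.
  apply: (@sub_finite_set _ _ (\bigcup_(N in `I_k)
    [set y - (t + b1) | y in [set` translate (x N) (F N)]])).
    move=> b Bb; apply: contrapT => nb; apply: no_b2; exists b.
    split=> // N ltNk.
    apply/negP => in_N; apply: nb; exists N => //; exists (t + b1 + b) => //.
    by rewrite addrC addKr.
  by apply: bigcup_finite => // N _; exact: finite_image.
have [N _ /= in_N] : (\bigcup_N [set` translate (x N) (F N)]) (t + b1 + b2).
  by apply: BBA; exists b1 => //; exists b2.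
have leqkN : (k <= N)%N by rewrite leqNgt; apply/negP => /far; rewrite in_N.
have [M _ /= in_M] : (\bigcup_N [set` translate (x N) (F N)]) (t + b2 + b2).
  by apply: BBA; exists b2 => //; exists b2.
rewrite !in_translate in in_N in_M.
apply: (x_escapes M N (t + b1 + b2 - x N + (t + b1 + b2 - x N) + e k)
                  (t + b2 + b2 - x M)) => //.
  by exists (t + b1 + b2 - x N) => //; exists k.
rewrite [RHS]addrC subrK addrA addrACA ![x N + _]addrC !subrK ek.
by rewrite {2}(addrAC t b1 b2) addrACA (addrC b2 b1) addrACA addrC addKr.
Qed.
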